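(* For any connected bipartite graph $G$, $$\frac{\Gamma_b(G)}{\alpha_{\mathrm{bn}}(G)}\le\frac{\Gamma_b(G)}{\alpha_{\mathrm{bnr}}(G)}<2.$$
   Context: All graphs are finite and simple. Let $d(u,v)$ denote distance and $e(v)$ the eccentricity of $v$. A broadcast on a connected graph $G=(V,E)$ is a function $f:V\to\{0,1,\dots,\operatorname{diam}(G)\}$ with $f(v)\le e(v)$ for all $v\in V$ if $|V|\ge 2$, and $f(v)=1$ if $V=\{v\}$. Let $V_f^+=\{v: f(v)>0\}$ and $\sigma(f)=\sum_{v\in V}f(v)$ (the weight). A vertex $u$ hears $f$ from $v\in V_f^+$ (and $v$ dominates $u$) if $d(u,v)\le f(v)$. $f$ is dominating if every vertex hears $f$ from some vertex of $V_f^+$. A dominating broadcast $f$ is minimal dominating if no broadcast $g\neq f$ with $g(v)\le f(v)$ for all $v$ is dominating. $\Gamma_b(G)$ is the maximum weight of a minimal dominating broadcast of $G$. For $v\in V_f^+$ let $N_f(v)=\{u:d(u,v)\le f(v)\}$, $B_f(v)=\{u:d(u,v)=f(v)\}$, and let the private boundary $\operatorname{PB}_f(v)$ be the set of $u\in N_f(v)$ that are not dominated by the function obtained from $f$ by changing the value at $v$ to $f(v)-1$. $f$ is irredundant if $\operatorname{PB}_f(v)\ne\varnothing$ for each $v\in V_f^+$. $f$ is bn-independent if $N_f(u)\cap N_f(v)\subseteq B_f(u)\cap B_f(v)$ for all distinct $u,v\in V_f^+$; it is bnr-independent if it is bn-independent and irredundant. $\alpha_{\mathrm{bn}}(G)$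 and $\alpha_{\mathrm{bnr}}(G)$ are the maximum weights of a bn-independent and a bnr-independent broadcast on $G$, respectively. *)

(* Defs.v *)
From mathcomp Require Import all_boot.

Set Implicit Arguments.
Unset Strict Implicit.
Unset Printing Implicit Defensive.

(* A graph is an edge relation e on a finite vertex type T; simplicity is
   [symmetric e] and [irreflexive e]. *)

Definition connected_graph (T : finType) (e : rel T) : Prop :=
  0 < #|T| /\ forall x y : T, connect e x y.

Definition bipartite (T : finType) (e : rel T) : Prop :=
  exists A : {set T}, forall x y : T, e x y -> (x \in A) != (y \in A).

(* A finite carrier through which every broadcast factors (broadcast_bfunE), so
   that extrema and quantifiers over broadcasts can be taken finitely. *)
Definition bfun (T : finType) := {ffun T -> 'I_#|T|.+1}.

Definition bfun_nat (T : finType) (f : bfun T) : T -> nat := fun v => f v.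
Coercion bfun_nat : bfun >-> Funclass.

Section Broadcasts.
Variables (T : finType) (e : rel T).

(* Least length of a walk from x to y; the default #|T| is only returned when
   there is none, since shortest walks have fewer than #|T| edges. *)
Definition dist (x y : T) : nat :=
  find (fun k => [exists p : k.-tuple T, path e x p && (last x p == y)])
       (iota 0 #|T|).

Definition ecc (v : T) : nat := \max_(u : T) dist v u.

Definition diam : nat := \max_(v : T) ecc v.

Definition is_broadcast (f : T -> nat) : bool :=
  if #|T| == 1 then [forall v, f v == 1]
  else [forall v, (f v <= diam) && (f v <= ecc v)].

Definition weight (f : T -> nat) : nat := \sum_(v : T) f v.

Definition hears (f : T -> nat) (u v : T) : bool :=
  (0 < f v) && (dist u v <= f v).

Definition dominated (f : T -> nat) (u : T) : bool := [exists v, hears f u v].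

Definition dominating (f : T -> nat) : bool := [forall u, dominated f u].

Definition nbh (f : T -> nat) (v : T) : {set T} := [set u | dist u v <= f v].

Definition boundary (f : T -> nat) (v : T) : {set T} :=
  [set u | dist u v == f v].

Definition decr (f : T -> nat) (v : T) : T -> nat :=
  fun x => if x == v then (f v).-1 else f x.

Definition private_boundary (f : T -> nat) (v : T) : {set T} :=
  [set u in nbh f v | ~~ dominated (decr f v) u].

Definition irredundant (f : T -> nat) : bool :=
  [forall v, (0 < f v) ==> (private_boundary f v != set0)].

Definition bn_independent (f : T -> nat) : bool :=
  [forall u, forall v, [&& 0 < f u, 0 < f v & u != v] ==>
    (nbh f u :&: nbh f v \subset boundary f u :&: boundary f v)].

Definition bnr_independent (f : T -> nat) : bool :=
  bn_independent f && irredundant f.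

Definition minimal_dominating (f : T -> nat) : bool :=
  [&& is_broadcast f, dominating f &
    [forall g : bfun T,
      [&& is_broadcast g, [exists v, g v != f v :> nat] & [forall v, g v <= f v]]
        ==> ~~ dominating g]].

Definition Gamma_b : nat :=
  \max_(f : bfun T | minimal_dominating f) weight f.

Definition alpha_bn : nat :=
  \max_(f : bfun T | is_broadcast f && bn_independent f) weight f.

Definition alpha_bnr : nat :=
  \max_(f : bfun T | is_broadcast f && bnr_independent f) weight f.

Lemma dist_le (x y : T) : dist x y <= #|T|.
Proof. by rewrite -[X in _ <= X](size_iota 0); apply: find_size. Qed.

Lemma broadcast_le (f : T -> nat) (v : T) : is_broadcast f -> f v <= #|T|.
Proof.
rewrite /is_broadcast; case: eqP => [-> /forallP/(_ v)/eqP -> //|_].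
move=> /forallP/(_ v)/andP[_ fv]; apply: leq_trans fv _.
by apply/bigmax_leqP => u _; apply: dist_le.
Qed.

Lemma broadcast_bfunE (f : T -> nat) :
  is_broadcast f -> exists g : bfun T, g =1 f.
Proof.
move=> bf; exists [ffun v => inord (f v)] => v.
by rewrite /bfun_nat ffunE inordK // ltnS broadcast_le.
Qed.

Lemma dist_path (x y : T) :
  connect e x y ->
  (exists p, [/\ path e x p, last x p = y & size p = dist x y]) /\
  (forall p, path e x p -> last x p = y -> dist x y <= size p).
Proof.
set P := fun k => [exists p : k.-tuple T, path e x p && (last x p == y)].
move=> /connectP[p0 p0P yE].
have [q [qP qE qs]] : exists q, [/\ path e x q, last x q = y & size q < #|T|].
  case/shortenP: p0P yE => q qP qU _ ->; exists q; split=> //.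
  by have := card_uniqP qU => /= <-; apply: max_card.
have hasP : has P (iota 0 #|T|).
  apply/hasP; exists (size q); first by rewrite mem_iota.
  by apply/existsP; exists (in_tuple q); rewrite qP qE eqxx.
have dlt : dist x y < #|T| by rewrite -[X in _ < X](size_iota 0) -has_find.
split.
  have := nth_find 0 hasP; rewrite -/(dist x y) nth_iota // add0n.
  case/existsP => p /andP[pP /eqP pE].
  by exists p; rewrite size_tuple.
move=> p pP pE; rewrite leqNgt; apply/negP => sp.
have := before_find 0 sp; rewrite nth_iota ?(ltn_trans sp) // add0n.
by move/existsP; apply; exists (in_tuple p); rewrite pP pE eqxx.
Qed.

Lemma dist0 (x : T) : dist x x = 0.
Proof.
apply/eqP; rewrite -leqn0.
by have [_ /(_ [::])] := dist_path (connect0 e x); apply.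
Qed.

Lemma dist_eq0 (x y : T) : connect e x y -> dist x y = 0 -> x = y.
Proof. by move=> /dist_path[[[|z p] [_ <- //=]]] <-. Qed.

Hypothesis e_sym : symmetric e.

Lemma distC (x y : T) : connect e x y -> dist x y = dist y x.
Proof.
have H u v : connect e u v -> dist v u <= dist u v.
  move=> uv; have [[p [pP pE <-]] _] := dist_path uv.
  have vu : connect e v u by rewrite sym_connect_sym.
  have [_ /(_ (rev (belast u p)))] := dist_path vu.
  rewrite size_rev size_belast; apply.
    rewrite -pE rev_path; under eq_path => ? ? do rewrite e_sym.
    by [].
  by case: p pP pE => [|z p] //= _ _; rewrite rev_cons last_rcons.
move=> xy; apply/eqP; rewrite eqn_leq !H //.
by rewrite sym_connect_sym.
Qed.

Lemma eq_is_broadcast (f g : T -> nat) :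
  f =1 g -> is_broadcast f = is_broadcast g.
Proof.
by move=> fg; congr (if _ then _ else _); apply: eq_forallb => v; rewrite fg.
Qed.

(* Rules out a zero denominator in ratios over alpha_bnr or alpha_bn. *)
Lemma alpha_bnr_gt0 : connected_graph e -> 0 < alpha_bnr.
Proof.
move=> [T0 conn]; have /card_gt0P[v _] := T0.
pose h u := if u == v then (if #|T| == 1 then 1 else ecc v) else 0.
have bh : is_broadcast h.
  rewrite /is_broadcast; case: ifP => c1; apply/forallP => u; rewrite /h c1.
    have -> : u = v by apply: (card_le1_eqP (A := T)) => //; rewrite (eqP c1).
    by rewrite eqxx.
  by case: eqP => // ->; rewrite leqnn andbT (leq_bigmax v).
have [g gh] := broadcast_bfunE bh.
have gv : g v = if #|T| == 1 then 1 else ecc v by rewrite gh /h eqxx.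
have gN u : u != v -> g u = 0 by rewrite gh /h => /negbTE ->.
have supp u : 0 < g u -> u = v.
  by move=> gu; apply/eqP; apply: contraTT gu => /gN ->.
have gpos : 0 < g v.
  rewrite gv; case: ifP => // c1.
  have /card_gt1P[x [y [_ _ xy]]] : 1 < #|T| by rewrite ltn_neqAle eq_sym c1.
  have [w wv] : exists w, w != v.
    by case: (eqVneq x v) xy => [-> vy|xv _]; [exists y; rewrite eq_sym | exists x].
  apply: leq_trans (leq_bigmax w); rewrite lt0n.
  by apply: contraNneq wv => /(dist_eq0 (conn _ _)) ->.
have ig : bnr_independent g.
  apply/andP; split.
    apply/forallP => x; apply/forallP => y; apply/implyP => /and3P[].
    by move=> /supp -> /supp ->; rewrite eqxx.
  apply/forallP => x; apply/implyP => /supp ->.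
  have [w wd] : exists w, g v = 1 /\ w = v \/ dist w v = g v.
    rewrite gv; case: ifP => c1; first by exists v; left.
    have [w E] := eq_bigmax (dist v) T0.
    by exists w; right; rewrite distC ?conn // -E.
  apply/set0Pn; exists w; rewrite !inE.
  apply/andP; split; first by case: wd => [[-> ->]|->] //; rewrite dist0.
  apply/existsP => -[z]; rewrite /hears /decr; case: (eqVneq z v) => [->|/gN -> //].
  case: wd => [[-> _]//|->].
  by move=> /andP[_]; rewrite leqNgt ltn_predL gpos.
apply: leq_trans (leq_bigmax_cond g _).
  by apply: leq_trans gpos _; rewrite /weight (bigD1 v) //= leq_addr.
by rewrite (eq_is_broadcast gh) bh.
Qed.

End Broadcasts.

(* Main.v *)
Require Import Defs.
From mathcomp Require Import all_boot all_order all_algebra.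
From mathcomp Require Import zify.

Import Order.TTheory GRing.Theory Num.Theory.
Local Open Scope ring_scope.

(** The order [n] of the graph separates the two parameters: [Gamma_b < n] and
    [n <= 2 * alpha_bnr] whenever [n > 1].

    The lower bound on [alpha_bnr] is where bipartiteness enters: the indicator
    function of an independent set is a bnr-independent broadcast
    ([independent_le_alpha_bnr]), and one of the two colour classes contains at
    least half of the vertices.

    For the upper bound, a minimal dominating broadcast [f] is irredundant
    ([minimal_dominating_irredundant]), so each broadcasting vertex [v] has some
    [u_v] in its private boundary.  The vertices lying on a shortest path from
    [v] to [u_v] number at least [f v].  These geodesics are pairwise disjoint
    for distinct [v] and [w]: at a common vertex one could exchange their tails,
    and since the two new walks have total length at most [f v + f w], either
    [u_v] would hear [w] or [u_w] would hear [v].  Hence the weight is at most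
    [n].  Equality forces [f] to be constantly 1, which is redundant because
    every vertex has a neighbour ([irredundant_weight_lt]).

    The one-vertex graph is separate, since its only broadcast has value 1. *)

Section BipartiteBound.
Local Open Scope nat_scope.
Variables (T : finType) (e : rel T).
Hypotheses (e_sym : symmetric e) (e_conn : connected_graph e).

Let conn x y : connect e x y. Proof. by case: e_conn. Qed.

Lemma dist_triangle y x z : dist e x z <= dist e x y + dist e y z.
Proof.
have [[p [pP pE <-]] _] := dist_path (conn x y).
have [[q [qP qE <-]] _] := dist_path (conn y z).
have [_ min] := dist_path (conn x z).
rewrite -size_cat; apply: min; first by rewrite cat_path pP pE qP.
by rewrite last_cat pE.
Qed.

Lemma dist_edge x y : e x y -> dist e x y <= 1.
Proof.
move=> xy; have [_ min] := dist_path (conn x y).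
by apply: (min [:: y]); rewrite //= xy.
Qed.

Lemma dist_le1 x y : dist e x y <= 1 -> x = y \/ e x y.
Proof.
have [[[|a [|b p]] [pP pE <-]] _] := dist_path (conn x y) => // _.
  by left.
by move: pP pE => /= /andP[xa _] <-; right.
Qed.

(** With [k = dist e v u] these are the vertices on shortest paths from [v] to
    [u].  The length bound [k] is a parameter so that the case [u = v], [k = 1]
    of a vertex in its own private boundary, where the set is [[set v]], needs no
    separate treatment. *)
Definition geodesic_set (v u : T) (k : nat) : {set T} :=
  [set x | dist e v x + dist e x u <= k].

Lemma geodesic_set_card {v u k} :
  dist e v u <= k -> dist e v u < #|geodesic_set v u k|.
Proof.
move=> duk; have [[p [pP pE pS]] min] := dist_path (conn v u).
case/shortenP: pP pE pS => q qP qU qp qE pS.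
have q_uniq : uniq q by case/andP: qU.
have qS : size q <= dist e v u by rewrite -pS; apply: uniq_leq_size.
apply: leq_ltn_trans (min q qP qE) _.
rewrite -[(size q).+1]/(size (v :: q)) -(card_uniqP qU).
apply/subset_leq_card/subsetP => x xq; rewrite inE.
apply: leq_trans duk; apply: leq_trans qS.
case/splitPl: q / xq qP qE {qU qp q_uniq} => q1 q2 q1E.
rewrite cat_path last_cat q1E size_cat => /andP[q1P q2P] q2E.
have [_ min1] := dist_path (conn v x).
have [_ min2] := dist_path (conn x u).
by apply: leq_add; [apply: min1 | apply: min2].
Qed.

(** Beyond distance [f v - 1] is where lowering the value at [v] loses vertices.
    The slack of one is due to [f v = 1]: the lowered value 0 does not even
    reach [v], so [v] may lie in its own private boundary. *)
Lemma private_boundary_dist {f v u} :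
  u \in private_boundary e f v -> 0 < f v ->
  dist e v u <= f v /\ f v <= (dist e v u).+1.
Proof.
rewrite !inE => /andP[uv /existsPn/(_ v)].
by rewrite /hears /decr eqxx -(distC e_sym (conn v u)) in uv *; lia.
Qed.

Lemma private_boundary_far {f v u w} :
  u \in private_boundary e f v -> 0 < f w -> w != v -> f w < dist e u w.
Proof.
rewrite !inE => /andP[_ /existsPn/(_ w)]; rewrite /hears /decr => H fw /negbTE wv.
by move: H; rewrite wv fw -ltnNge.
Qed.

(** At a common vertex [x], the detours from [uv] through [x] to [w] and from [uw]
    through [x] to [v] have total length at most [f v + f w], whereas privacy
    makes each of them longer than the value at its end. *)
Lemma geodesic_set_disjoint f v w uv uw :
  0 < f v -> 0 < f w -> v != w ->
  uv \in private_boundary e f v -> uw \in private_boundary e f w ->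
  [disjoint geodesic_set v uv (f v) & geodesic_set w uw (f w)].
Proof.
move=> fv fw vw uvP uwP.
rewrite -setI_eq0; apply/eqP/setP => x; rewrite !inE; apply/negP => /andP[xv xw].
have wv : w != v by rewrite eq_sym.
have far_uv := leq_trans (private_boundary_far uvP fw wv) (dist_triangle x uv w).
have far_uw := leq_trans (private_boundary_far uwP fv vw) (dist_triangle x uw v).
move: (leq_add far_uv far_uw) (leq_add xv xw).
rewrite (distC e_sym (conn uv x)) (distC e_sym (conn uw x)).
rewrite (distC e_sym (conn x w)) (distC e_sym (conn x v)) => lb ub.
lia.
Qed.

Lemma exists_neighbour v : 1 < #|T| -> exists w, e v w.
Proof.
case/card_gt1P => x [y [_ _ xy]].
have [z zv] : exists z, z != v.
  by case: (eqVneq x v) xy => [-> vy|xv _]; [exists y; rewrite eq_sym | exists x].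
have /connectP[[|w p] /= pP zE] := conn v z; first by rewrite zE eqxx in zv.
by exists w; case/andP: pP.
Qed.

Hypothesis e_irr : irreflexive e.
Hypothesis nontrivial : 1 < #|T|.

(** Disjointness of the geodesic sets gives weight at most [#|T|].  In case of
    equality all values are 1, and then [u v] hears a vertex other than [v]:
    itself when [u v != v], and a neighbour of [v] when [u v = v]. *)
Lemma irredundant_weight_lt f : irredundant e f -> weight f < #|T|.
Proof.
move=> /forallP irr.
have [u uP] : exists u : T -> T,
    forall v, 0 < f v -> u v \in private_boundary e f v.
  exists (fun v => odflt v [pick x in private_boundary e f v]) => v fv.
  case: pickP => //= none; have /set0Pn[x] := implyP (irr v) fv.
  by rewrite none.
pose P v := if 0 < f v then geodesic_set v (u v) (f v) else set0.
have P_disj v w : v != w -> [disjoint P v & P w].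
  rewrite /P; case: ifP => fv; case: ifP => fw vw; rewrite -setI_eq0 ?setI0 ?set0I //.
  by rewrite setI_eq0 geodesic_set_disjoint ?uP.
have P_card v : f v <= #|P v| ?= iff (f v == #|P v|).
  apply/leqifP; rewrite /P; case: posnP => [->|fv]; first by rewrite cards0.
  case: eqP => // /eqP neq; rewrite ltn_neqAle neq.
  have [ub lb] := private_boundary_dist (uP _ fv) fv.
  exact: leq_trans lb (geodesic_set_card ub).
have sum_le : \sum_v #|P v| <= #|T|.
  under eq_bigr => v _ do rewrite -sum1_card.
  by rewrite -partition_disjoint_bigcup // sum1_card max_card.
have w_le : weight f <= \sum_v #|P v| by apply: leq_sum => v _; case: (P_card v).
rewrite ltn_neqAle (leq_trans w_le sum_le) andbT; apply/eqP => wT.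
have P_eq v : f v = #|P v|.
  apply/eqP; move: (leqif_sum (fun v (_ : true) => P_card v)) => [_].
  rewrite -/(weight f) eqn_leq w_le wT sum_le => /esym/forall_inP; exact.
(* Otherwise a geodesic set with only [f v] vertices puts [u v] at distance less
   than [f v], where it still hears [v] after the value is lowered, unless that
   value becomes 0. *)
have f_le1 v : f v <= 1.
  case: (posnP (f v)) => [-> //|fv].
  have [ub _] := private_boundary_dist (uP _ fv) fv.
  have := geodesic_set_card ub; move: (P_eq v); rewrite /P fv => <- lt_d.
  have := uP _ fv; rewrite !inE => /andP[_ /existsPn/(_ v)].
  rewrite /hears /decr eqxx (distC e_sym (conn (u v) v)).
  case: (f v) lt_d => [|[|k]] //=; rewrite ltnS => ->.
  by [].
have f1 v : f v = 1.
  apply/eqP; move: (leqif_sum (fun v (_ : true) => leqif_eq (f_le1 v))) => [_].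
  by rewrite sum1_card -/(weight f) wT eqxx => /esym/forall_inP; apply.
have [v _] := card_gt0P (ltnW nontrivial).
have := uP v; rewrite !inE f1 => /(_ isT)/andP[_ /existsPn undom].
have hears_decr w : w != v -> dist e (u v) w <= 1 -> False.
  move=> wv dw; have := undom w.
  by rewrite /hears /decr (negbTE wv) f1 dw.
have [uv|uv] := eqVneq (u v) v; last by apply: (hears_decr (u v)); rewrite ?dist0.
have [w vw] := exists_neighbour v nontrivial.
apply: (hears_decr w); last by rewrite uv dist_edge.
by apply: contraTneq vw => ->; rewrite e_irr.
Qed.

(** Lowering [f] at a vertex with empty private boundary would leave a smaller
    dominating broadcast. *)
Lemma minimal_dominating_irredundant f :
  minimal_dominating e f -> irredundant e f.
Proof.
case/and3P => fB /forallP fD /forallP fM.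
apply/forallP => v; apply/implyP => fv; apply/negP => /eqP PB0.
have n1 : (#|T| == 1) = false by rewrite gtn_eqF.
have decr_le x : decr f v x <= f x.
  by rewrite /decr; case: eqP => // ->; apply: leq_pred.
have decrB : is_broadcast e (decr f v).
  move: fB; rewrite /is_broadcast n1 => /forallP fB; apply/forallP => x.
  by have /andP[d ec] := fB x; rewrite !(leq_trans (decr_le x)).
have [g gE] := broadcast_bfunE decrB.
have /implyP := fM g; rewrite (eq_is_broadcast e gE) decrB /= => H.
have /H/negP[] : [exists x, g x != f x] && [forall x, g x <= f x].
  apply/andP; split; last by apply/forallP => x; rewrite gE.
  by apply/existsP; exists v; rewrite gE /decr eqxx -(prednK fv) ltn_eqF.
have domE x : dominated e g x = dominated e (decr f v) x.
  by apply: eq_existsb => z; rewrite /hears gE.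
apply/forallP => x; rewrite domE.
have [xN|xN] := boolP (x \in nbh e f v).
  have := in_set0 x; rewrite -PB0 inE xN /=; exact: negbFE.
have /existsP[z /andP[fz xz]] := fD x.
have zv : z != v by apply: contraNneq xN => <-; rewrite inE.
by apply/existsP; exists z; rewrite /hears /decr (negbTE zv) fz.
Qed.

(** Give value 1 to the vertices of the independent set [A].  Two unit balls
    centred in [A] can only meet at distance 1 from both centres, and each
    centre hears only itself, hence is its own private boundary vertex. *)
Lemma independent_le_alpha_bnr (A : {set T}) :
  {in A &, forall x y, ~~ e x y} -> #|A| <= alpha_bnr e.
Proof.
move=> indep.
have A_far x y : x \in A -> y \in A -> dist e x y <= 1 -> x = y.
  by move=> xA yA /dist_le1[//|xy]; have := indep x y xA yA; rewrite xy.
pose f x : nat := x \in A.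
have supp x : 0 < f x -> x \in A by rewrite lt0b.
have ecc_gt0 v : 0 < ecc e v.
  have [w vw] := exists_neighbour v nontrivial.
  apply: leq_trans (leq_bigmax w); rewrite lt0n.
  by apply: contraTneq vw => /(dist_eq0 (conn _ _)) ->; rewrite e_irr.
have fB : is_broadcast e f.
  rewrite /is_broadcast gtn_eqF //; apply/forallP => v.
  have fv : f v <= ecc e v by apply: leq_trans (leq_b1 _) (ecc_gt0 v).
  by rewrite fv (leq_trans fv) // (leq_bigmax v).
have [g gE] := broadcast_bfunE fB.
have gA x : 0 < g x -> x \in A by rewrite gE; apply: supp.
have g1 x : x \in A -> g x = 1 by rewrite gE /f => ->.
have ->: #|A| = weight g.
  by rewrite /weight (eq_bigr f) // -sum1_card [RHS]big_mkcond [LHS]big_mkcond.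
apply: (leq_bigmax_cond g); rewrite (eq_is_broadcast e gE) fB /=.
apply/andP; split.
  apply/forallP => x; apply/forallP => y; apply/implyP => /and3P[/gA xA /gA yA xy].
  apply/subsetP => w; rewrite !inE !g1 // => /andP[wx wy].
  rewrite !eqn_leq wx wy !lt0n /=; apply/andP; split; apply: contraNneq xy.
    by move=> /(dist_eq0 (conn _ _)) wE; apply/eqP/A_far => //; rewrite -wE.
  move=> /(dist_eq0 (conn _ _)) wE; apply/eqP/A_far => //.
  by rewrite (distC e_sym) // -wE.
apply/forallP => x; apply/implyP => /gA xA; apply/set0Pn; exists x.
rewrite !inE dist0 /=; apply/existsPn => z; rewrite /hears /decr.
case: (eqVneq z x) => [_|zx]; first by rewrite g1.
apply/negP => /andP[/gA zA]; rewrite g1 // => /(A_far _ _ xA zA) E.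
by rewrite E eqxx in zx.
Qed.

Lemma bipartite_card_le : bipartite e -> #|T| <= 2 * alpha_bnr e.
Proof.
case=> A bip.
have A_le : #|A| <= alpha_bnr e.
  apply: independent_le_alpha_bnr => x y xA yA; apply/negP => /bip.
  by rewrite xA yA.
have Ac_le : #|~: A| <= alpha_bnr e.
  apply: independent_le_alpha_bnr => x y; rewrite !inE => /negbTE xA /negbTE yA.
  by apply/negP => /bip; rewrite xA yA.
by rewrite -(cardsC A) mul2n -addnn leq_add.
Qed.

End BipartiteBound.

Lemma Gamma_b_lt (T : finType) (e : rel T) :
  symmetric e -> irreflexive e -> connected_graph e -> bipartite e ->
  (Gamma_b e < 2 * alpha_bnr e)%N.
Proof.
move=> e_sym e_irr e_conn e_bip; have pos := alpha_bnr_gt0 e_sym e_conn.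
case: (ltnP 1 #|T|) => n1.
  apply: leq_trans (bipartite_card_le _ _ e_sym e_conn e_irr n1 e_bip).
  rewrite -(ltn_predK n1) ltnS; apply/bigmax_leqP => f fM.
  rewrite -ltnS (ltn_predK n1); apply: irredundant_weight_lt => //.
  exact: minimal_dominating_irredundant.
have {n1} n1 : #|T| == 1%N by rewrite eqn_leq n1; case: e_conn.
apply: (@leq_ltn_trans 1); last by rewrite (leq_mul2l 2 1) pos.
apply/bigmax_leqP => f /and3P[]; rewrite /is_broadcast n1 => /forallP fB _ _.
rewrite /weight (eq_bigr (fun=> 1%N)) => [|v _]; last exact/eqP.
by rewrite sum1_card (eqP n1).
Qed.

Lemma alpha_bnr_le_bn (T : finType) (e : rel T) : (alpha_bnr e <= alpha_bn e)%N.
Proof.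
apply/bigmax_leqP => f /and3P[fB fI _].
by apply: (leq_bigmax_cond f); rewrite fB.
Qed.

Theorem proposition5p3 (T : finType) (e : rel T)
    (e_sym : symmetric e) (e_irr : irreflexive e)
    (e_conn : connected_graph e) (e_bip : bipartite e) :
  (Gamma_b e)%:R / (alpha_bn e)%:R <= (Gamma_b e)%:R / (alpha_bnr e)%:R :> rat
  /\ (Gamma_b e)%:R / (alpha_bnr e)%:R < 2%:R :> rat.
Proof.
have pos := alpha_bnr_gt0 e_sym e_conn.
have pos_bn := leq_trans pos (alpha_bnr_le_bn _ e).
split; last first.
  by rewrite ltr_pdivrMr ?ltr0n // -natrM ltr_nat Gamma_b_lt.
rewrite ler_wpM2l ?ler0n // lef_pV2 ?posrE ?ltr0n // ler_nat.
exact: alpha_bnr_le_bn.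
Qed.
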